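(* Let $\theta>0$ and, for $x>0$, let $X(t)=x-N_t$, where $N_t$ is a homogeneous Poisson process with intensity $\theta$ and $N_0=0$. Let $\tau(x)=\inf\{t>0: X(t)\le 0\}$, $A(x)=\int_0^{\tau(x)}X(t)\,dt$, and $V_{m,n}(x)=E[\tau(x)^mA(x)^n]$, which is the solution of the problem $$\theta\,[V_{m,n}(x-1)-V_{m,n}(x)]=-n\,x\,V_{m,n-1}(x)-m\,V_{m-1,n}(x)\ \ (x>0),\qquad V_{m,n}(y)=0\ \ (y\le 0),\qquad \lim_{\theta\to+\infty}V_{m,n}(x)=0.$$ For integers $m,n\ge 0$, the solution of this problem vanishes at zero, and it is a polynomial of degree $m+2n$ if $x\in\mathbf N$; otherwise (if $x\notin\mathbf N$) it has a polynomial growth of degree $m+2n$.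
   Context: $\tau(x)$ is the first-passage time of $X$ below zero and $A(x)$ is the area swept out by $X$ up to time $\tau(x)$ (first-passage area). The starting point $x>0$ is a real number, and $x\in\mathbf N$ means that $x$ is a positive integer. In the equation, a term with zero coefficient $n$ or $m$ is understood to be $0$.
   Formalization: The claim that V_{m,n} is the unique solution of the problem is stated only for (m,n) ≠ (0,0): for m=n=0 the problem forces the zero solution, whereas V_{0,0}=E[1]=1 for x>0. The claims on V(0)=0, the polynomial and the growth cover all m,n ≥ 0. *)

(* Defs.v *)
From HB Require Import structures.
From mathcomp Require Import all_boot all_order all_algebra.
From mathcomp Require Import all_classical all_reals all_analysis.
Set Implicit Arguments.
Unset Strict Implicit.
Unset Printing Implicit Defensive.
Import Order.TTheory GRing.Theory Num.Theory.
Import numFieldNormedType.Exports.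
Local Open Scope classical_set_scope.
Local Open Scope ring_scope.

(* Only the times [t >= 0] are meaningful. Increments are natural-number
   subtractions; they are not truncated because the paths are nondecreasing.
   The law of an increment is only prescribed for [s < t]: the library's
   [poisson_pmf] is the constant 1 at rate 0. Independence of the increments is
   the product rule for all choices of value sets [B i] (taking [B i = setT]
   covers subfamilies). *)
Record poisson_process (R : realType) (d : measure_display)
    (T : measurableType d) (P : probability T R) (theta : R)
    (N : R -> T -> nat) : Prop := PoissonProcess {
  poisson_process_measurable : forall t, 0 <= t -> measurable_fun setT (N t) ;
  poisson_process_start : forall w, N 0 w = 0%N ;
  poisson_process_nondecreasing : forall w s t,
    0 <= s -> s <= t -> (N s w <= N t w)%N ;
  poisson_process_right_continuous : forall w t, 0 <= t ->
    (N s w)%:R @[s --> t^'+] --> ((N t w)%:R : R) ;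
  poisson_process_increment_law : forall s t k, 0 <= s -> s < t ->
    P [set w | (N t w - N s w)%N = k] =
      (poisson_pmf (theta * (t - s)) k)%:E ;
  poisson_process_increment_indep :
    forall (l : nat) (t : nat -> R) (B : nat -> set nat),
    0 <= t 0%N -> (forall i, t i <= t i.+1) ->
    P (\bigcap_(i in [set i | (i < l)%N])
         [set w | B i (N (t i.+1) w - N (t i) w)%N]) =
      (\prod_(i < l) P [set w | B i (N (t i.+1) w - N (t i) w)%N])%E }.

(* Infimum in the extended reals, so it is [+oo] when the path never reaches
   [(-oo, 0]]. *)
Definition passage_time (R : realType) (X : R -> R) : \bar R :=
  ereal_inf [set t%:E | t in [set t | 0 < t /\ X t <= 0]].

Definition passage_area (R : realType) (X : R -> R) : \bar R :=
  (\int[lebesgue_measure]_(t in [set t : R | (0 <= t)%R /\ t%:E <= passage_time X])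
     (X t)%:E)%E.

Definition passage_monomial (R : realType) (T : Type) (N : R -> T -> nat)
    (m n : nat) (x : R) (w : T) : \bar R :=
  let X t := x - (N t w)%:R in
  (passage_time X ^+ m * passage_area X ^+ n)%E.

(* The process starts from [x > 0]; at [x <= 0] the moments are extended by 0,
   which is the boundary condition of the difference problem. In particular the
   moment of order (0, 0) is the indicator of [x > 0]. *)
Definition passage_moment (R : realType) (d : measure_display)
    (T : measurableType d) (P : probability T R) (N : R -> T -> nat)
    (m n : nat) (x : R) : R :=
  if 0 < x then fine (\int[P]_w passage_monomial N m n x w)%E else 0.

(* The problem of order (m, n) for the unknown [U theta x], with the family
   [V m n theta x] providing the moments of lower order. When [n = 0]
   (resp. [m = 0]) the predecessor is junk, but its coefficient is zero. *)
Definition moment_problem (R : realType) (V : nat -> nat -> R -> R -> R)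
    (m n : nat) (U : R -> R -> R) : Prop :=
  [/\ forall theta x, 0 < theta -> 0 < x ->
        theta * (U theta (x - 1) - U theta x) =
          - n%:R * x * V m n.-1 theta x - m%:R * V m.-1 n theta x,
      forall theta y, 0 < theta -> y <= 0 -> U theta y = 0
    & forall x, U theta x @[theta --> +oo] --> (0 : R)].

(* Main.v *)
(* Let [s_j] be the time of the [j]-th jump and [c] the least integer [>= x].
   Almost surely [tau = s_c] and [A = sum_(i < c) (x - i) (s_(i+1) - s_i)]. Let
   [tau_t] and [A_t] be the time and the area that remain at time [t]. On each
   interval [[s_j, s_(j+1)[] the product [tau_t^m A_t^n] is a polynomial in [t],
   and integrating its derivative up to [tau] gives
     tau^m A^n = sum_(j < c) int 1_(N_t = j)
       (m tau_t^(m-1) A_t^n + n (x - j) tau_t^m A_t^(n-1)) dt.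
   By Tonelli and the Markov property at the deterministic time [t], the
   expectation of the integrand is [P (N_t = j)] times a combination of the
   lower order moments from [x - j], and [P (N_t = j)] has integral [1 / theta]
   over [t > 0]. Hence [V m n x] is [1 / theta] times the sum over [j < c] of
   [m V (m-1) n (x - j) + n (x - j) V m (n-1) (x - j)], which is the recursion in
   [x]; degrees and growth follow from it by induction on [m + n]. *)

Require Import Defs.
From HB Require Import structures.
From mathcomp Require Import all_boot all_order all_algebra.
From mathcomp Require Import ring lra zify.
From mathcomp Require Import all_classical all_reals all_analysis.
From mathcomp Require Import measurable_realfun.
Set Implicit Arguments.
Unset Strict Implicit.
Unset Printing Implicit Defensive.
Import Order.TTheory GRing.Theory Num.Theory.
Import numFieldNormedType.Exports.
Local Open Scope classical_set_scope.
Local Open Scope ring_scope.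

(** * Jump times of a counting path *)

Section CountingPath.
Variable R : realType.
Implicit Types (f : R -> nat) (t s x : R) (j c m n : nat).

(** For integer values, right continuity is constancy on some [[t, t + e[]. A jump of size above one
    merely makes consecutive jump times equal. *)
Record counting_path f : Prop := CountingPath {
  counting_path0 : f 0 = 0%N ;
  counting_path_le : forall s t, 0 <= s -> s <= t -> (f s <= f t)%N ;
  counting_path_right : forall t, 0 <= t ->
    exists2 e, 0 < e & forall s, t <= s -> s < t + e -> f s = f t }.

Definition reaches f c := exists2 t, 0 <= t & (c <= f t)%N.

Definition shift_path f t s := (f (t + s)%R - f t)%N.

(** The real [inf] of the empty set is 0, so this is a jump time only when [reaches f j] holds;
    hence that premise in most lemmas on jump times. *)
Definition jump_time f j : R := inf [set t | 0 <= t /\ (j <= f t)%N].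

Lemma counting_path_shift f t : 0 <= t -> counting_path f ->
  counting_path (shift_path f t).
Proof.
move=> t0 [f0 fle fr]; split.
- by rewrite /shift_path addr0 subnn.
- move=> s u s0 su; rewrite leq_sub2r// fle ?addr_ge0// lerD2l //.
- move=> s s0; have [|e e0 he] := fr (t + s); first exact: addr_ge0.
  exists e => // u su us; rewrite /shift_path he//; lra.
Qed.

Lemma reaches_leq f i j : (i <= j)%N -> reaches f j -> reaches f i.
Proof. by move=> ij [t t0 jt]; exists t => //; exact: leq_trans jt. Qed.

Lemma reaches_shift f t c : 0 <= t -> counting_path f -> reaches f c ->
  reaches (shift_path f t) (c - f t).
Proof.
move=> t0 [_ fle _] [s s0 cs]; exists s => //.
by rewrite leq_sub2r// (leq_trans cs)// fle// lerDr.
Qed.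

Lemma jump_time_ge0 f j : 0 <= jump_time f j.
Proof.
rewrite /jump_time; set A := [set _ | _].
have [->|A0] := eqVneq A set0; first by rewrite inf0.
by apply: lb_le_inf => [|t []//]; exact/set0P.
Qed.

(** Constancy to the right of [s] makes the infimum attained. Most later facts on jump times are
    read off this equivalence. *)
Lemma jump_time_le f j s : counting_path f -> reaches f j -> 0 <= s ->
  (jump_time f j <= s) = (j <= f s)%N.
Proof.
move=> [f0 fle fr] [t0 t0ge jt0] s0; rewrite /jump_time; set A := [set _ | _].
have A0 : A !=set0 by exists t0.
have lA : has_lbound A by exists 0 => t [].
have As : has_inf A by [].
apply/idP/idP => [infs|js]; last by apply: ge_inf.
have [e e0 he] := fr _ s0.
have [t [t0' jt] ts] : exists2 t, A t & t < s + e.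
  by apply/inf_lt => //; lra.
have [st|ts'] := leP s t; first by rewrite -(he t).
by rewrite (leq_trans jt)// fle// ltW.
Qed.

Lemma eq_ge0_le (a b : R) : 0 <= a -> 0 <= b ->
  (forall s, 0 <= s -> (a <= s) = (b <= s)) -> a = b.
Proof.
move=> a0 b0 ab; apply/le_anti.
by rewrite ab// lexx -ab// lexx.
Qed.

Lemma jump_time0 f : counting_path f -> jump_time f 0 = 0.
Proof.
move=> hf; apply/eqP; rewrite eq_le jump_time_ge0 andbT.
by rewrite jump_time_le//; exists 0.
Qed.

(** The index is a successor: at index 0 the shifted path has jump time 0, whereas
    [jump_time f (f t)] lies at or before [t]. *)
Lemma jump_time_shift f t i : counting_path f -> 0 <= t ->
  reaches f (f t + i.+1) ->
  jump_time (shift_path f t) i.+1 = jump_time f (f t + i.+1) - t.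
Proof.
move=> hf t0 hr.
have hr' : reaches (shift_path f t) i.+1.
  by have := reaches_shift t0 hf hr; rewrite addKn.
apply: eq_ge0_le; first exact: jump_time_ge0.
  rewrite subr_ge0 leNgt; apply/negP => /ltW.
  by rewrite jump_time_le// leqNgt addnS ltnS leq_addr.
move=> s s0; rewrite (jump_time_le (counting_path_shift t0 hf))//.
rewrite lerBlDl (jump_time_le hf) ?addr_ge0//.
by rewrite /shift_path leq_subRL// (counting_path_le hf)// lerDl.
Qed.

Lemma jump_time_mono f i j : counting_path f -> reaches f j -> (i <= j)%N ->
  jump_time f i <= jump_time f j.
Proof.
move=> hf hj ij; rewrite jump_time_le ?jump_time_ge0//; last first.
  exact: reaches_leq hj.
by rewrite (leq_trans ij)// -jump_time_le// jump_time_ge0.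
Qed.

Lemma jump_time_between f j t : counting_path f -> reaches f j.+1 -> 0 <= t ->
  (jump_time f j <= t < jump_time f j.+1) = (f t == j).
Proof.
move=> hf hj t0; have hj' := reaches_leq (leqnSn j) hj.
by rewrite ltNge !jump_time_le// -ltnNge ltnS eqn_leq andbC.
Qed.

End CountingPath.

(** * Area and monomials in terms of the jump times *)

Section StepArea.
Variable R : realType.
Implicit Types (s : nat -> R) (t x : R) (i j c m n : nat).

(* In this section [s j] stands for the [j]-th jump time of a path of [N]; the
   process [x - N] equals [x - i] on [[s i, s i.+1[]. *)
Definition tail_area x c s j := \sum_(j <= i < c) (x - i%:R) * (s i.+1 - s i).

(** The area that remains at a time [t] of the [j]-th interval: the unfinished step, then the full
    steps after it. *)
Definition rest_area x c s j t :=
  (x - j%:R) * (s j.+1 - t) + tail_area x c s j.+1.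

Definition monomial m n x c s := s c ^+ m * tail_area x c s 0 ^+ n.

(** Minus the time derivative of the remaining product: the remaining time decreases at speed 1, the
    remaining area at speed [x - j]. *)
Definition monomial_speed m n x c s j t :=
  m%:R * ((s c - t) ^+ m.-1 * rest_area x c s j t ^+ n) +
  n%:R * (x - j%:R) * ((s c - t) ^+ m * rest_area x c s j t ^+ n.-1).

Lemma tail_area_recl x c s j : (j < c)%N ->
  tail_area x c s j = rest_area x c s j (s j).
Proof. by move=> jc; rewrite /tail_area big_ltn. Qed.

(** At [s j.+1] step [j] is exhausted, so what remains there is the tail from [j.+1] and the sum
    telescopes. The last term vanishes because [0 < m + n]; recall that [0 ^+ 0] is 1. *)
Lemma monomial_telescope m n x c s : (0 < m + n)%N -> s 0%N = 0 ->
  monomial m n x c s = \sum_(j < c)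
    ((s c - s j) ^+ m * rest_area x c s j (s j) ^+ n -
     (s c - s j.+1) ^+ m * rest_area x c s j (s j.+1) ^+ n).
Proof.
move=> mn s0; pose a j := (s c - s j) ^+ m * tail_area x c s j ^+ n.
have ac : a c = 0.
  rewrite /a subrr /tail_area big_geq// !expr0n -natrM mulnb.
  by rewrite -addn_eq0 -leqn0 leqNgt mn.
have -> : monomial m n x c s = a 0%N - a c by rewrite ac subr0 /a s0 subr0.
rewrite -opprB -(telescope_sumr a (leq0n c)) big_mkord -sumrN.
apply: eq_bigr => j _; rewrite opprB /a tail_area_recl//.
by rewrite [X in _ = _ - _ * X ^+ _]/rest_area subrr mulr0 add0r.
Qed.

Lemma integral_deriv_horner (p : {poly R}) (a b : R) : a <= b ->
  (\int[lebesgue_measure]_(t in `[a, b[) (p^`().[t])%:E = (p.[b] - p.[a])%:E)%E.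
Proof.
rewrite le_eqVlt => /predU1P[->|ab].
  by rewrite set_itvco0 integral_set0 subrr.
rewrite integral_itv_bndo_bndc; last first.
  apply/measurable_EFinP; apply: measurable_funTS; apply: continuous_measurable_fun.
  exact: continuous_horner.
rewrite (@continuous_FTC2 _ _ (horner p))//.
- exact/continuous_subspaceT/continuous_horner.
- split => [t _|/=|/=]; first exact: derivable_horner.
  + exact/cvg_at_right_filter/continuous_horner.
  + exact/cvg_at_left_filter/continuous_horner.
- by move=> t _; rewrite derivE.
Qed.

Lemma integral_monomial_speed m n x c s j : s j <= s j.+1 ->
  (\int[lebesgue_measure]_(t in `[s j, s j.+1[) (monomial_speed m n x c s j t)%:E =
   ((s c - s j) ^+ m * rest_area x c s j (s j) ^+ n -
     (s c - s j.+1) ^+ m * rest_area x c s j (s j.+1) ^+ n)%:E)%E.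
Proof.
(* [p] is minus the remaining product as a polynomial in [t], so its derivative is
   [monomial_speed]. *)
move=> sj; pose p : {poly R} := - (((s c)%:P - 'X) ^+ m *
  (((x - j%:R) * s j.+1 + tail_area x c s j.+1)%:P - (x - j%:R) *: 'X) ^+ n).
have pE t : p.[t] = - ((s c - t) ^+ m * rest_area x c s j t ^+ n).
  rewrite /p !hornerE; congr (- (_ * _ ^+ _)).
  by rewrite /rest_area; ring.
have dpE t : p^`().[t] = monomial_speed m n x c s j t.
  rewrite /p derivN derivM !deriv_exp !derivB !derivC derivZ derivX /monomial_speed.
  rewrite !(hornerN, hornerD, hornerM, hornerMn, horner_exp, hornerC, hornerX, hornerZ).
  have -> : (x - j%:R) * s j.+1 + tail_area x c s j.+1 - (x - j%:R) * t =
    rest_area x c s j t by rewrite /rest_area; ring.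
  rewrite -[_ *+ m]mulr_natl -[_ *+ n]mulr_natl.
  move: (_ ^+ m) (_ ^+ n) (_ ^+ m.-1) (_ ^+ n.-1) (x - _) => a b a' b' y; ring.
under eq_integral do rewrite -dpE.
by rewrite integral_deriv_horner// !pE opprK addrC.
Qed.

(** [c%:R - 1 <= x] makes every height [x - i] with [i < c] nonnegative. Monotonicity is asked up to
    [c] only, since later jumps may not occur. *)
Lemma tail_area_ge0 x c s j : c%:R - 1 <= x ->
  (forall i k, (i <= k <= c)%N -> s i <= s k) -> 0 <= tail_area x c s j.
Proof.
move=> cx hs; rewrite /tail_area big_nat_cond sumr_ge0// => i /andP[/andP[_ ic] _].
by rewrite mulr_ge0// subr_ge0 ?hs ?leqnSn// (le_trans _ cx)// lerBrDr natr1 ler_nat.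
Qed.

Lemma rest_area_ge0 x c s j t : (j < c)%N -> c%:R - 1 <= x ->
  (forall i k, (i <= k <= c)%N -> s i <= s k) -> t <= s j.+1 ->
  0 <= rest_area x c s j t.
Proof.
move=> jc cx hs tj; rewrite addr_ge0 ?tail_area_ge0// mulr_ge0 ?subr_ge0//.
by rewrite (le_trans _ cx)// lerBrDr natr1 ler_nat.
Qed.

Lemma monomial_speed_ge0 m n x c s j t : (j < c)%N -> c%:R - 1 <= x ->
  (forall i k, (i <= k <= c)%N -> s i <= s k) -> t <= s j.+1 ->
  0 <= monomial_speed m n x c s j t.
Proof.
move=> jc cx hs tj; have r0 := rest_area_ge0 jc cx hs tj.
have xj : 0 <= x - j%:R by rewrite subr_ge0 (le_trans _ cx)// lerBrDr natr1 ler_nat.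
have st : 0 <= s c - t by rewrite subr_ge0 (le_trans tj)// hs// jc leqnn.
by rewrite addr_ge0 ?mulr_ge0 ?exprn_ge0.
Qed.

End StepArea.

(** Restarting at [t] translates the later jump times by [t], while the one of index 0 becomes 0:
    the first step of the new path is the unfinished step of the old one. *)
Lemma rest_area_shift (R : realType) (f : R -> nat) (t x : R) (c j : nat) :
  counting_path f -> reaches f c -> 0 <= t -> f t = j -> (j < c)%N ->
  rest_area x c (jump_time f) j t =
  tail_area (x - j%:R) (c - j) (jump_time (shift_path f t)) 0.
Proof.
move=> hf hr t0 ftj jc.
have shE i : (i < c - j)%N ->
    jump_time (shift_path f t) i.+1 = jump_time f (i.+1 + j) - t.
  move=> ic; rewrite jump_time_shift// ftj addnC//.
  by apply: reaches_leq hr; rewrite addnC; lia.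
rewrite tail_area_recl ?subn_gt0// /rest_area.
rewrite (jump_time0 (counting_path_shift t0 hf)) !subr0 shE ?subn_gt0// add1n.
congr (_ + _); rewrite /tail_area -(add1n j) big_addn big_nat [RHS]big_nat.
apply: eq_bigr => i /andP[i1 ic].
rewrite shE//; case: i i1 ic => // i _ ic; rewrite shE; last exact: ltnW.
by rewrite natrD addSn; ring.
Qed.

(** * Measurability of the jump times and of the quantities built on them *)

Section JumpTimeMeasurability.
Context d (T : measurableType d) (R : realType).
Implicit Types (D : set T) (N : R -> T -> nat).

(** On [D], the jump time exceeds [y >= 0] exactly when [N y < j], an event about a single time; for
    [y < 0] it always does. *)
Lemma measurable_jump_time D N j : measurable D ->
  (forall t, 0 <= t -> measurable_fun setT (N t)) ->
  (forall w, D w -> counting_path (N^~ w) /\ reaches (N^~ w) j) ->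
  measurable_fun D (fun w => jump_time (N^~ w) j).
Proof.
move=> mD mN hD _; apply: (measurability _ (RGenOInfty.measurableE R)) => //.
move=> _ [_ [y ->] <-].
have [y0|y0] := leP 0 y; last first.
  suff -> : D `&` (fun w => jump_time (N^~ w) j) @^-1` `]y, +oo[ = D by [].
  apply/seteqP; split => [w []//|w Dw]; split => //=.
  by rewrite in_itv/= andbT (lt_le_trans y0)// jump_time_ge0.
have -> : D `&` (fun w => jump_time (N^~ w) j) @^-1` `]y, +oo[ =
    D `&` (fun w => (N y w < j)%N) @^-1` [set true].
  apply/seteqP; split => w [Dw] /=; have [hw rw] := hD w Dw;
  by rewrite in_itv/= andbT ltNge jump_time_le// -ltnNge.
apply: (measurable_funTS (measurable_fun_ltn (mN y y0) (measurable_cst j))) => //.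
Qed.

Context d' (X : measurableType d').
Implicit Types (s : nat -> X -> R) (t : X -> R) (A : set X).

(** The space [X] is arbitrary because such facts serve both on [T] and on [T * R], the latter for
    Tonelli. *)
Lemma measurable_tail_area A s x c j :
  (forall i, (i <= c)%N -> measurable_fun A (s i)) ->
  measurable_fun A (fun z => tail_area x c (s^~ z) j).
Proof.
move=> ms; rewrite /tail_area; under eq_fun do rewrite big_nat_cond big_mkcond.
apply: measurable_sum => i; rewrite andbT.
case: (boolP (j <= i < c)%N) => [/andP[_ ic]|_]; last exact: measurable_cst.
apply: measurable_funM => //.
by apply: measurable_funB; apply: ms => //; exact: ltnW.
Qed.

Lemma measurable_monomial A s m n x c :
  (forall i, (i <= c)%N -> measurable_fun A (s i)) ->
  measurable_fun A (fun z => monomial m n x c (s^~ z)).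
Proof.
move=> ms; apply: measurable_funM; apply: measurable_funX; first exact: ms.
exact: measurable_tail_area.
Qed.

Lemma measurable_rest_area A s t x c j :
  (forall i, (i <= c)%N -> measurable_fun A (s i)) ->
  measurable_fun A t -> (j < c)%N ->
  measurable_fun A (fun z => rest_area x c (s^~ z) j (t z)).
Proof.
move=> ms mt jc; apply: measurable_funD; last exact: measurable_tail_area.
by apply: measurable_funM => //; apply: measurable_funB => //; exact: ms.
Qed.

Lemma measurable_monomial_speed A s t m n x c j :
  (forall i, (i <= c)%N -> measurable_fun A (s i)) ->
  measurable_fun A t -> (j < c)%N ->
  measurable_fun A (fun z => monomial_speed m n x c (s^~ z) j (t z)).
Proof.
move=> ms mt jc.
by apply: measurable_funD; apply: measurable_funM => //;
  apply: measurable_funM; apply: measurable_funX;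
  do ?[exact: measurable_rest_area | apply: measurable_funB => //; exact: ms].
Qed.

End JumpTimeMeasurability.

(** * Poisson weights *)

Section PoissonPmf.
Variable R : realType.
Implicit Types (theta u t : R) (k : nat).

(** Agrees with [poisson_pmf] for [u > 0], but without a case distinction at rate 0, so that it is
    differentiable everywhere. *)
Definition poisson_weight u k : R := u ^+ k / k`!%:R * expR (- u).

Lemma poisson_weight_ge0 u k : 0 <= u -> 0 <= poisson_weight u k.
Proof. by move=> u0; rewrite mulr_ge0 ?expR_ge0// divr_ge0 ?exprn_ge0. Qed.

Lemma poisson_pmfE u k : 0 < u -> poisson_pmf u k = poisson_weight u k.
Proof. by rewrite /poisson_pmf => ->. Qed.

(** The exponential dominates the term of order [k.+1] of its series. The bound gives both the decay
    in time and the almost sure reaching of every level. *)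
Lemma poisson_weight_le u k : 0 < u -> poisson_weight u k <= k.+1%:R / u.
Proof.
move=> u0; rewrite /poisson_weight expRN ler_pdivrMr ?expR_gt0//.
have h : u ^+ k.+1 / k.+1`!%:R <= expR u.
  by rewrite (le_trans _ (expR_ge1Dxn k (ltW u0)))// lerDr.
rewrite -ler_pdivrMl; last by rewrite divr_gt0.
apply: le_trans h; rewrite le_eqVlt; apply/orP; left; apply/eqP.
rewrite factS natrM exprS; field.
by rewrite gt_eqF ?ltr0n ?fact_gt0//= gt_eqF ?nat1r//= gt_eqF.
Qed.

Lemma poisson_weight_cvg0 theta k : 0 < theta ->
  poisson_weight (theta * t) k @[t --> +oo] --> 0.
Proof.
move=> th0; apply/cvgrPdist_le => e e0; near=> t.
have t0 : 0 < t by near: t; exact: nbhs_pinfty_gt.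
have tt0 : 0 < theta * t by rewrite mulr_gt0.
rewrite sub0r normrN ger0_norm ?poisson_weight_ge0 ?(ltW tt0)//.
rewrite (le_trans (poisson_weight_le _ _))// ler_pdivrMr//.
rewrite mulrA -ler_pdivrMl ?mulr_gt0//.
Unshelve. all: by end_near. Qed.

(** The forward equations of the Poisson process; summed over the indices up to [k], they
    telescope. *)
Lemma is_derive_poisson_weight theta t k :
  is_derive t (1 : R) (fun t => poisson_weight (theta * t) k)
    (theta * ((if k is k'.+1 then poisson_weight (theta * t) k' else 0) -
              poisson_weight (theta * t) k)).
Proof.
have he : is_derive t (1 : R) (fun t => expR (- (theta * t)))
    (- theta * expR (- (theta * t))).
  apply: trigger_derive; rewrite /GRing.scale/=; ring.
case: k => [|k].
  have w0 u : poisson_weight u 0 = expR (- u).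
    by rewrite /poisson_weight expr0 fact0 invr1 !mul1r.
  under eq_fun do rewrite w0.
  by apply: is_derive_eq; rewrite w0 sub0r mulrN mulNr.
have -> : (fun t => poisson_weight (theta * t) k.+1) =
    (fun t => (theta * t) ^+ k.+1 / (k.+1)`!%:R) * (fun t => expR (- (theta * t))).
  by [].
have hp : is_derive t (1 : R) (fun t => (theta * t) ^+ k.+1 / (k.+1)`!%:R)
    (theta * ((theta * t) ^+ k / k`!%:R)).
  pose p : {poly R} := (theta ^+ k.+1 / (k.+1)`!%:R) *: 'X^(k.+1).
  have -> : (fun t => (theta * t) ^+ k.+1 / (k.+1)`!%:R) = horner p.
    by apply/funext => u; rewrite /p hornerZ hornerXn exprMn mulrAC.
  apply: is_derive_eq; rewrite /p derivZ derivXn hornerZ hornerMn hornerXn.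
  rewrite exprMn exprS factS natrM -mulr_natl /=; field.
  by rewrite gt_eqF ?ltr0n ?fact_gt0//= gt_eqF ?nat1r.
by apply: is_derive_eq; rewrite /GRing.scale/= /poisson_weight; ring.
Qed.

(** The antiderivative [F] is [- theta^-1] times the Poisson distribution function at [k]: it is
    [- theta^-1] at 0 and tends to 0 at infinity. *)
Lemma integral_poisson_pmf theta k : 0 < theta ->
  (\int[lebesgue_measure]_(t in `]0%R, +oo[) (poisson_pmf (theta * t) k)%:E =
   (theta^-1)%:E)%E.
Proof.
move=> th0.
pose w i t := poisson_weight (theta * t) i.
pose F t := - theta^-1 * \sum_(i < k.+1) w i t.
have dF t : is_derive t (1 : R) F (w k t).
  have -> : F = - theta^-1 \*: (\sum_(i < k.+1) w i).
    by apply/funext => u; rewrite /F /GRing.scale /= fct_sumE.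
  have dw (i : 'I_k.+1) := is_derive_poisson_weight theta t i.
  apply: is_derive_eq.
  rewrite -mulr_sumr sumrB big_ord_recl big_ord_recr/= add0r opprD addNKr.
  by rewrite /GRing.scale/= /w; field; rewrite gt_eqF.
have cw t : {for t, continuous (w k)}.
  apply: differentiable_continuous; apply/derivable1_diffP.
  by have [] := is_derive_poisson_weight theta t k.
have cF t : {for t, continuous F}.
  by apply: differentiable_continuous; apply/derivable1_diffP; case: (dF t).
(* On the open interval the rate is positive, so [poisson_pmf] is the weight; the endpoint 0 has
   measure zero. *)
transitivity (\int[lebesgue_measure]_(t in `[0%R, +oo[) (w k t)%:E)%E.
  rewrite -integral_itv_obnd_cbnd; last first.
    apply/measurable_EFinP; apply: measurable_funTS.
    by apply: continuous_measurable_fun => t; exact: cw.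
  apply: eq_integral => t /[!inE]/= /[!in_itv]/= /[!andbT] t0.
  by rewrite poisson_pmfE ?mulr_gt0.
rewrite (@ge0_continuous_FTC2y _ (w k) F 0 0).
- have -> : F 0 = - theta^-1.
    rewrite /F big_ord_recl big1 => [|i _]; rewrite /w /poisson_weight mulr0.
      by rewrite oppr0 expR0 expr0 fact0 invr1 !mulr1 addr0 mulr1.
    by rewrite expr0n !mul0r.
  by rewrite sub0e -EFinN opprK.
- by move=> t t0; rewrite poisson_weight_ge0// mulr_ge0// ltW.
- exact: continuous_subspaceT.
- rewrite -(mulr0 (- theta^-1)); apply: cvgMr.
  rewrite [X in _ --> X](_ : 0 = \sum_(i < k.+1) 0); last by rewrite big1.
  by apply: cvg_big => [|i _]; [exact: add_continuous|exact: poisson_weight_cvg0].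
- by move=> t _; case: (dF t).
- exact/cvg_at_right_filter/cF.
- by move=> t _; rewrite derive1E; apply: derive_val.
Qed.

End PoissonPmf.

(* The moment of order [(m, n)] at unit intensity, with [s = m + n] as fuel and
   [c] the number of jumps needed to reach [x]. The predecessors of [0] are junk,
   with a zero coefficient. *)
Fixpoint unit_moment (R : realType) (s m n c : nat) (x : R) : R :=
  if s is s'.+1 then
    \sum_(j < c)
      (m%:R * unit_moment s' m.-1 n (c - j) (x - j%:R) +
       n%:R * (x - j%:R) * unit_moment s' m n.-1 (c - j) (x - j%:R))
  else 1.

Lemma sub_level_ge (R : realType) c j (x : R) : (j < c)%N -> c%:R - 1 <= x ->
  (c - j)%:R - 1 <= x - j%:R /\ 0 <= x - j%:R.
Proof.
move=> jc cx; split; first by rewrite natrB ?(ltnW jc)// addrAC lerB.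
by rewrite subr_ge0 (le_trans _ cx)// lerBrDr natr1 ler_nat.
Qed.

Lemma unit_moment_ge0 (R : realType) s m n c (x : R) :
  c%:R - 1 <= x -> 0 <= unit_moment s m n c x.
Proof.
elim: s => [//|s IH] in m n c x * => cx /=.
apply: sumr_ge0 => j _; have [cx' xj] := sub_level_ge (ltn_ord j) cx.
by rewrite addr_ge0 ?mulr_ge0// IH.
Qed.

(** The term [j = 0] is split off; reindexed, the others form the sum for [x - 1] and [c]. This is
    the difference equation at unit intensity. *)
Lemma unit_moment_recl (R : realType) s m n c (x : R) :
  unit_moment s.+1 m n c.+1 x = unit_moment s.+1 m n c (x - 1) +
    (m%:R * unit_moment s m.-1 n c.+1 x + n%:R * x * unit_moment s m n.-1 c.+1 x).
Proof.
rewrite /= big_ord_recl /= subn0 subr0 addrC; congr (_ + _).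
apply: eq_bigr => j _; rewrite /bump/= add1n subSS -addrA.
by have -> : - j.+1%:R = -1 - j%:R :> R by rewrite -natr1; ring.
Qed.

(** * Moments of the jump times *)

Section PassageExpectation.
Context d (T : measurableType d) (R : realType) (P : probability T R) (theta : R).
Implicit Types (D : set T) (N : R -> T -> nat).

(* [N] is a Poisson process given [D]: this is stable under conditioning on
   [N t = j] and restarting at [t], without changing the measure. *)
Record poisson_on D N c : Prop := PoissonOn {
  poisson_on_domain : measurable D ;
  poisson_on_measurable : forall t, 0 <= t -> measurable_fun setT (N t) ;
  poisson_on_path : forall w, counting_path (N^~ w) ;
  poisson_on_reaches : forall w, D w -> reaches (N^~ w) c ;
  poisson_on_law : forall l (t : nat -> R) (k : nat -> nat),
    t 0%N = 0 -> (forall i, t i < t i.+1) ->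
    P (D `&` \bigcap_(i in [set i | (i < l)%N])
               [set w | (N (t i.+1) w - N (t i) w)%N = k i]) =
    (P D * (\prod_(i < l) poisson_pmf (theta * (t i.+1 - t i)) (k i))%:E)%E }.

Definition shift_process N t s w := shift_path (N^~ w) t s.

Lemma poisson_on_level D N c t j : poisson_on D N c -> 0 < t ->
  P (D `&` [set w | N t w = j]) = (P D * (poisson_pmf (theta * t) j)%:E)%E.
Proof.
move=> [_ _ hpath _ hlaw] t0.
(* The law of increments with a single increment, along the grid of multiples of [t]. *)
have := hlaw 1%N (fun i => i%:R * t) (fun=> j).
rewrite /= mul0r big_ord1 /= mul1r mul0r subr0 => <-//; last first.
  by move=> i; rewrite ltr_pM2r// ltr_nat.
congr (P (_ `&` _)); apply/seteqP; split => [w <- [|//] _|w /(_ 0%N isT)] /=;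
by rewrite mul1r mul0r (counting_path0 (hpath w)) subn0.
Qed.

Lemma measurable_level D N c t j : poisson_on D N c -> 0 <= t ->
  measurable (D `&` [set w | N t w = j]).
Proof.
move=> [mD mN _ _ _] t0; apply: measurableI => //.
by rewrite -[X in measurable X]setTI; exact: (mN t t0 measurableT [set j]).
Qed.

(** The Markov property at time [t]: the law of [l.+1] increments, the first of them over [[0, t]]
    with value [j], factors into the law of the new domain and that of the remaining increments. *)
Lemma poisson_on_shift D N c t j : poisson_on D N c -> 0 < t ->
  poisson_on (D `&` [set w | N t w = j]) (shift_process N t) (c - j).
Proof.
move=> hN t0; have [mD mN hpath hreach hlaw] := hN; split.
- exact: measurable_level hN (ltW t0).
- move=> s s0; rewrite /shift_process /shift_path.
  by apply: measurable_fun_subn; apply: mN; rewrite ?addr_ge0// ltW.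
- by move=> w; apply: counting_path_shift => //; exact: ltW.
- move=> w [Dw <-].
  exact: (@reaches_shift _ (N^~ w) _ _ (ltW t0) (hpath w) (hreach w Dw)).
- move=> l s k s0 hs; rewrite (poisson_on_level _ hN t0) -muleA -EFinM.
  pose s' i := if i is i'.+1 then t + s i' else 0.
  pose k' i := if i is i'.+1 then k i' else j.
  have hs' i : s' i < s' i.+1 by case: i => [|i] /=; rewrite ?s0 ?addr0// ltrD2l.
  have := hlaw l.+1 s' k' erefl hs'.
  rewrite big_ord_recl/= s0 addr0 subr0.
  under eq_bigr => i _ do rewrite opprD addrACA subrr add0r.
  move=> <-; congr (P _); rewrite -setIA; congr (_ `&` _).
  (* By monotonicity none of the natural-number subtractions is truncated, so the value at [t]
     cancels. *)
  have sh i w : (0 <= s i)%R ->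
      (shift_process N t (s i.+1) w - shift_process N t (s i) w =
      N (t + s i.+1)%R w - N (t + s i)%R w)%N.
    move=> si; have si' := ltW (hs i); have t0' := ltW t0.
    have : (N t w <= N (t + s i)%R w)%N.
      by rewrite (counting_path_le (hpath w)) ?lerDl.
    have : (N (t + s i)%R w <= N (t + s i.+1)%R w)%N.
      by rewrite (counting_path_le (hpath w)) ?addr_ge0 ?lerD2l.
    rewrite /shift_process /shift_path /=.
    by move: (N (t + s i.+1)%R w) (N (t + s i)%R w) (N t w) => a b e; lia.
  have s_ge0 i : 0 <= s i by elim: i => [|i ih]; rewrite ?s0// (le_trans ih)// ltW.
  apply/seteqP; split => [w [/= Nt hw] [_|i /= il]|w hw] /=.
  + by rewrite s0 addr0 (counting_path0 (hpath w)) subn0.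
  + by rewrite -sh//; exact: hw.
  + split=> [|i /= il]; last by rewrite sh//; exact: (hw i.+1).
    by have := hw 0%N isT; rewrite /= s0 addr0 (counting_path0 (hpath w)) subn0.
Qed.

(** The difference is the integral of the speed over the [j]-th interval. After exchanging the
    integrals, the condition that [t] lies in this interval becomes the event [N t w = j]. *)
Lemma integral_step_tonelli D N m n x c j : poisson_on D N c -> (j < c)%N ->
  c%:R - 1 <= x ->
  let s i w := jump_time (N^~ w) i in
  (\int[P]_(w in D)
     ((s c w - s j w) ^+ m * rest_area x c (s^~ w) j (s j w) ^+ n -
      (s c w - s j.+1 w) ^+ m * rest_area x c (s^~ w) j (s j.+1 w) ^+ n)%:E =
   \int[lebesgue_measure]_(t in `]0%R, +oo[)
     \int[P]_(w in D `&` [set w | N t w = j])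
        (monomial_speed m n x c (s^~ w) j t)%:E)%E.
Proof.
move=> hN jc cx s; have [mD mN hpath hreach _] := hN.
have ic_reach i w : D w -> (i <= c)%N -> reaches (N^~ w) i.
  by move=> Dw ic; exact: reaches_leq ic (hreach w Dw).
have smono w i k : D w -> (i <= k <= c)%N -> s i w <= s k w.
  by move=> Dw /andP[ik kc]; apply: jump_time_mono => //; exact: ic_reach.
(* Jump times are set to 0 outside [D]: they become measurable on all of [T], and the intervals
   there are empty, so that [h] vanishes. *)
pose S i := s i \_ D.
have SD i w : D w -> S i w = s i w by move=> Dw; rewrite /S patchE mem_set.
have SND i w : ~ D w -> S i w = 0 by move=> Dw; rewrite /S patchE memNset.
have mS i : (i <= c)%N -> measurable_fun setT (S i).
  move=> ic; apply/(measurable_restrictT _ mD).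
  apply: (@measurable_jump_time _ T R D N i mD mN).
  by move=> w Dw; split; [exact: hpath|exact: ic_reach].
pose h (z : T * R) : \bar R := if (S j z.1 <= z.2) && (z.2 < S j.+1 z.1)
  then (monomial_speed m n x c (S^~ z.1) j z.2)%:E else 0%E.
have mh : measurable_fun setT h.
  have mS1 i : (i <= c)%N -> measurable_fun setT (fun z : T * R => S i z.1).
    by move=> ic; apply: measurableT_comp (mS i ic) _.
  apply: measurable_fun_ifT.
  - by apply: measurable_and; [apply: measurable_fun_ler|apply: measurable_fun_ltr];
      rewrite //; apply: mS1 => //; exact: ltnW.
  - apply/measurable_EFinP.
    exact: (@measurable_monomial_speed R _ (T * R)%type setT (fun i z => S i z.1) snd
      m n x c j mS1 measurable_snd jc).
  - exact: measurable_cst.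
have Seq w : D w -> S^~ w = s^~ w by move=> Dw; apply/funext => i; exact: SD.
have h0 z : (0 <= h z)%E.
  rewrite /h; case: ifPn => // /andP[Sz zS]; rewrite lee_fin.
  have [Dz|Dz] := pselect (D z.1); last first.
    by move: (le_lt_trans Sz zS); rewrite !SND// ltxx.
  rewrite Seq//; apply: monomial_speed_ge0 => //.
    by move=> i k; exact: smono.
  by rewrite -SD// ltW.
transitivity (\int[P]_w \int[lebesgue_measure]_t h (w, t))%E.
  rewrite integral_mkcond; apply: eq_integral => w _; rewrite patchE.
  have [Dw|Dw] := pselect (D w); last first.
    rewrite memNset// integral0_eq// => t _; rewrite /h /= !SND//.
    by rewrite ltNge; case: (0 <= t).
  rewrite mem_set// -(@integral_monomial_speed _ m n x c (s^~ w));
    last by apply: smono; rewrite // leqnSn.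
  rewrite integral_mkcond; apply: eq_integral => t _; rewrite patchE /h/=.
  by rewrite !SD// Seq// mem_setE in_itv.
rewrite fubini_tonelli//.
transitivity (\int[lebesgue_measure]_(t in `[0%R, +oo[) \int[P]_w h (w, t))%E.
  rewrite [RHS]integral_mkcond; apply: eq_integral => t _; rewrite patchE.
  rewrite mem_setE in_itv/= andbT; case: ifPn => // t0.
  apply: integral0_eq => w _; rewrite /h /=.
  rewrite ifF//; apply/negbTE/negP => /andP[St _]; move/negP: t0; apply.
  apply: le_trans St; have [Dw|Dw] := pselect (D w); last by rewrite SND.
  by rewrite SD// jump_time_ge0.
(* The null point [t = 0] is dropped, as restarting is done at positive times. *)
rewrite -integral_itv_obnd_cbnd; last first.
  by apply: measurable_funTS; exact: measurable_fun_fubini_tonelli_G.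
apply: eq_integral => t; rewrite inE/= in_itv/= andbT => t0.
rewrite [RHS]integral_mkcond; apply: eq_integral => w _; rewrite patchE /h/=.
have [Dw|Dw] := pselect (D w); last first.
  rewrite !SND// memNset; last by case.
  by rewrite ltNge; case: (0 <= t).
rewrite !SD// Seq// jump_time_between ?ltW//; last exact: ic_reach.
case: eqP => [Nt|Nt]; first by rewrite mem_set.
by rewrite memNset// => -[].
Qed.

Hypothesis theta_gt0 : 0 < theta.

Lemma measurable_jump_monomial D N m n x c : poisson_on D N c ->
  measurable_fun D (fun w => monomial m n x c (jump_time (N^~ w))).
Proof.
move=> [mD mN hpath hreach _].
apply: (@measurable_monomial R _ T D (fun i w => jump_time (N^~ w) i)) => i ic.
apply: (@measurable_jump_time _ T R D N i mD mN) => w Dw; split; first exact: hpath.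
exact: reaches_leq ic (hreach w Dw).
Qed.

Lemma jump_monomial_ge0 D N m n x c w : poisson_on D N c -> c%:R - 1 <= x -> D w ->
  0 <= monomial m n x c (jump_time (N^~ w)).
Proof.
move=> [_ _ hpath hreach _] cx Dw; rewrite mulr_ge0 ?exprn_ge0 ?jump_time_ge0//.
apply: tail_area_ge0 => // i k /andP[ik kc]; apply: jump_time_mono => //.
exact: reaches_leq kc (hreach w Dw).
Qed.

(** On [N t w = j] the speed combines two monomials of total order [s] of the restarted process. The
    induction hypothesis, a premise here, is applied with this event as the new domain. *)
Lemma integral_level_speed D N m n x c s t j :
  (forall m' n' D' N' c' x', (m' + n')%N = s -> c'%:R - 1 <= x' -> poisson_on D' N' c' ->
    (\int[P]_(w in D') (monomial m' n' x' c' (jump_time (N'^~ w)))%:E =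
     P D' * (unit_moment s m' n' c' x' / theta ^+ s)%:E)%E) ->
  (m + n)%N = s.+1 -> c%:R - 1 <= x -> poisson_on D N c -> (j < c)%N -> 0 < t ->
  (\int[P]_(w in D `&` [set w | N t w = j])
        (monomial_speed m n x c (jump_time (N^~ w)) j t)%:E =
   P (D `&` [set w | N t w = j]) *
     ((m%:R * unit_moment s m.-1 n (c - j) (x - j%:R) +
       n%:R * (x - j%:R) * unit_moment s m n.-1 (c - j) (x - j%:R)) / theta ^+ s)%:E)%E.
Proof.
move=> IH mns cx hN jc t0; have hN' := poisson_on_shift j hN t0.
have [_ _ hpath hreach _] := hN.
set D' := D `&` _ in hN' *; set N' := shift_process N t in hN'.
have [cx' xj] := sub_level_ge jc cx.
have mD' : measurable D' by case: hN'.
pose f m' n' w := monomial m' n' (x - j%:R) (c - j) (jump_time (N'^~ w)).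
have mf m' n' : measurable_fun D' (f m' n') by exact: measurable_jump_monomial hN'.
have f0 m' n' w : D' w -> 0 <= f m' n' w.
  by move=> D'w; apply: (jump_monomial_ge0 _ _ hN').
transitivity (\int[P]_(w in D') (m%:R%:E * (f m.-1 n w)%:E +
    (n%:R * (x - j%:R))%:E * (f m n.-1 w)%:E))%E.
  apply: eq_integral => w; rewrite inE => -[Dw Nt].
  rewrite -!EFinM -EFinD /monomial_speed.
  rewrite (rest_area_shift x (hpath w) (hreach w Dw) (ltW t0) Nt jc).
  have -> // : jump_time (N^~ w) c - t = jump_time (N'^~ w) (c - j).
  rewrite -(subnSK jc) jump_time_shift//.
  - by rewrite Nt subnSK// subnKC// ltnW.
  - exact: ltW.
  - by rewrite Nt subnSK// subnKC ?(ltnW jc)//; exact: hreach.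
have hZ (k : R) m' n' : 0 <= k -> (k != 0 -> (m' + n')%N = s) ->
    (\int[P]_(w in D') (k%:E * (f m' n' w)%:E) =
     P D' * (k * unit_moment s m' n' (c - j) (x - j%:R) / theta ^+ s)%:E)%E.
  move=> k0 hk; rewrite ge0_integralZl_EFin//; last 2 first.
  - by move=> w D'w; rewrite lee_fin f0.
  - exact/measurable_EFinP.
  have [->|kn0] := eqVneq k 0; first by rewrite !mul0r mul0e mule0.
  by rewrite IH ?hk// muleCA -EFinM mulrA.
rewrite ge0_integralD//; first last.
- apply/measurable_EFinP; exact: measurable_funM.
- by move=> w D'w; rewrite lee_fin mulr_ge0 ?f0// mulr_ge0.
- apply/measurable_EFinP; exact: measurable_funM.
- by move=> w D'w; rewrite lee_fin mulr_ge0 ?f0.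
rewrite !hZ ?mulr_ge0//; last 2 first.
- by case: (n) mns => [|n'] mns; [rewrite mulr0n mul0r eqxx | move=> _; lia].
- by case: (m) mns => [|m'] mns; [rewrite mulr0n eqxx | move=> _; lia].
by rewrite -muleDr ?fin_num_measure// -EFinD -mulrDl.
Qed.

(** The induction generalizes over [D] and [N] because the process is restarted. Each step adds one
    factor [theta^-1], the time integral of the Poisson probability of level [j]. *)
Lemma integral_jump_monomial s m n D N c x : (m + n)%N = s ->
  c%:R - 1 <= x -> poisson_on D N c ->
  (\int[P]_(w in D) (monomial m n x c (jump_time (N^~ w)))%:E =
   P D * (unit_moment s m n c x / theta ^+ s)%:E)%E.
Proof.
elim: s => [|s IH] in m n D N c x *.
  move=> /eqP; rewrite addn_eq0 => /andP[/eqP-> /eqP->] _ [mD _ _ _ _].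
  rewrite /monomial; under eq_integral do rewrite !expr0 mulr1.
  by rewrite integral_cst// mul1e divr1 mule1.
move=> mns cx hN; have [mD mN hpath hreach _] := hN.
pose S i w := jump_time (N^~ w) i.
have smono w i k : D w -> (i <= k <= c)%N -> S i w <= S k w.
  move=> Dw /andP[ik kc]; apply: jump_time_mono => //.
  exact: reaches_leq kc (hreach w Dw).
have mS i : (i <= c)%N -> measurable_fun D (S i).
  move=> ic; apply: (@measurable_jump_time _ T R D N i mD mN) => w Dw.
  split; first exact: hpath.
  exact: reaches_leq ic (hreach w Dw).
pose g (j : 'I_c) w :=
  ((S c w - S j w) ^+ m * rest_area x c (S^~ w) j (S j w) ^+ n -
   (S c w - S j.+1 w) ^+ m * rest_area x c (S^~ w) j (S j.+1 w) ^+ n).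
transitivity (\int[P]_(w in D) \sum_(j < c) (g j w)%:E)%E.
  apply: eq_integral => w; rewrite inE => Dw.
  by rewrite monomial_telescope ?mns ?jump_time0// sumEFin.
rewrite ge0_integral_sum//; last 2 first.
- move=> j; apply/measurable_EFinP.
  apply: measurable_funB; apply: measurable_funM; apply: measurable_funX.
  + by apply: measurable_funB; apply: mS => //; exact: ltnW.
  + by apply: measurable_rest_area => //; apply: mS; exact: ltnW.
  + by apply: measurable_funB; apply: mS.
  + by apply: measurable_rest_area => //; apply: mS.
- move=> j w Dw; rewrite -(@integral_monomial_speed _ m n x c (S^~ w)); last first.
    by apply: smono; rewrite // leqnSn/=.
  apply: integral_ge0 => t /=; rewrite in_itv/= => /andP[_ tS].
  rewrite lee_fin; apply: monomial_speed_ge0 => //; last exact: ltW.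
  by move=> i k; exact: smono.
pose K (j : 'I_c) := m%:R * unit_moment s m.-1 n (c - j) (x - j%:R) +
    n%:R * (x - j%:R) * unit_moment s m n.-1 (c - j) (x - j%:R).
have PD : P D = (fine (P D))%:E by rewrite fineK// fin_num_measure.
transitivity (\sum_(j < c) (fine (P D) * (K j / theta ^+ s.+1))%:E)%E; last first.
  by rewrite sumEFin -mulr_sumr -mulr_suml EFinM -PD.
apply: eq_bigr => j _.
rewrite (integral_step_tonelli _ _ hN)//.
transitivity (\int[lebesgue_measure]_(t in `]0%R, +oo[)
   ((fine (P D) * (K j / theta ^+ s))%:E * (poisson_pmf (theta * t) j)%:E))%E.
  apply: eq_integral => t; rewrite inE/= in_itv/= andbT => t0.
  rewrite (integral_level_speed IH)// (poisson_on_level _ hN t0) PD -!EFinM.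
  by congr EFin; rewrite /K; ring.
rewrite ge0_integralZl//; last first.
- rewrite lee_fin mulr_ge0 ?fine_ge0// divr_ge0 ?exprn_ge0 ?(ltW theta_gt0)//.
  have [cx' xj] := sub_level_ge (ltn_ord j) cx.
  by rewrite addr_ge0 ?mulr_ge0// unit_moment_ge0.
- by move=> t _; rewrite lee_fin poisson_pmf_ge0.
- apply/measurable_EFinP.
  apply: (measurableT_comp (measurable_poisson_pmf j measurableT)).
  exact: measurable_funM.
rewrite integral_poisson_pmf// -EFinM; congr EFin.
rewrite exprS; field; rewrite expf_neq0 gt_eqF//.
Qed.

End PassageExpectation.

(** * Passage time and area of a path *)

Section PassagePath.
Variable R : realType.
Implicit Types (f : R -> nat) (x : R) (c m n : nat).

(** The two bounds say that [c] is the ceiling of [x]; an integer is at least [x] exactly when it is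
    at least [c]. *)
Lemma path_below_level f x c t : c%:R - 1 < x -> x <= c%:R ->
  (x - (f t)%:R <= 0) = (c <= f t)%N.
Proof.
move=> cx xc; rewrite subr_le0; apply/idP/idP => [xf|cf].
  by rewrite -ltnS -(ltr_nat R) -natr1 -ltrBlDr (lt_le_trans cx).
by rewrite (le_trans xc)// ler_nat.
Qed.

Lemma measurable_path f x (D : set R) : counting_path f -> measurable D ->
  (forall t, D t -> 0 <= t) -> measurable_fun D (fun t => x - (f t)%:R).
Proof.
move=> hf mD D0; apply: measurable_funB => //.
(* Freezing the path at its value at 0 for negative times makes it nondecreasing on the whole line,
   hence measurable. *)
apply: (eq_measurable_fun (fun t : R => (f (Num.max 0 t))%:R : R)).
  by move=> t /[!inE] /D0 t0; rewrite max_r.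
apply: nondecreasing_measurable => // s t st.
rewrite ler_nat; apply: (counting_path_le hf); first by rewrite le_max lexx.
by rewrite ge_max !le_max lexx st orbT.
Qed.

(** The infimum is attained at the [c]-th jump time, which is positive because [f 0 = 0] while
    [0 < x] forces [0 < c]. *)
Lemma passage_time_jump f x c : counting_path f -> reaches f c -> 0 < x ->
  c%:R - 1 < x -> x <= c%:R ->
  passage_time (fun t => x - (f t)%:R) = (jump_time f c)%:E.
Proof.
move=> hf hr x0 cx xc; rewrite /passage_time.
have s0 := jump_time_ge0 f c.
apply/eqP; rewrite eq_le; apply/andP; split.
  apply: ereal_inf_lbound; exists (jump_time f c) => //; split.
    rewrite lt_neqAle s0 andbT eq_sym gt_eqF// ltNge jump_time_le//.
    by rewrite (counting_path0 hf) -ltnNge -(ltr_nat R) (lt_le_trans x0).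
  by rewrite (path_below_level _ _ cx xc) -jump_time_le.
apply: le_ereal_inf_tmp => _ [t [t0 xt] <-].
rewrite lee_fin jump_time_le ?(ltW t0)//.
by rewrite -(path_below_level _ _ cx xc).
Qed.

Lemma integral_steps f x c k : counting_path f -> reaches f c -> c%:R - 1 <= x ->
  (k <= c)%N ->
  (\int[lebesgue_measure]_(t in `[0%R, jump_time f k[) (x - (f t)%:R)%:E =
   (tail_area x k (jump_time f) 0)%:E)%E.
Proof.
move=> hf hr cx; elim: k => [|k IH] kc.
  by rewrite jump_time0// set_itvco0 integral_set0 /tail_area big_geq.
have hk : reaches f k by apply: reaches_leq hr; exact: ltnW.
have hk' : reaches f k.+1 by apply: reaches_leq hr.
have sk : jump_time f k <= jump_time f k.+1 by apply: jump_time_mono.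
have U : `[0%R, jump_time f k.+1[%classic =
    `[0%R, jump_time f k[%classic `|` `[jump_time f k, jump_time f k.+1[%classic.
  apply/seteqP; split => t /=; rewrite !in_itv/=.
    move=> /andP[t0 tk]; have [tk'|tk'] := ltP t (jump_time f k).
      by left; rewrite t0.
    by right.
  move=> [/andP[t0 tk]|/andP[tk tk']].
    by rewrite t0 (lt_le_trans tk).
  by rewrite tk' (le_trans _ tk)// jump_time_ge0.
rewrite U ge0_integral_setU//; first last.
- apply/disj_set2P/seteqP; split => // t [] /=.
  rewrite !in_itv/= => /andP[_ tk] /andP[kt _].
  by move: (lt_le_trans tk kt); rewrite ltxx.
- rewrite -U => t /=; rewrite in_itv/= => /andP[t0 tk].
  rewrite lee_fin subr_ge0 (le_trans _ cx)// lerBrDr natr1 ler_nat.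
  by rewrite (leq_trans _ kc)// ltnNge -jump_time_le// -ltNge.
- rewrite -U; apply/measurable_EFinP; apply: measurable_path => // t /=.
  by rewrite in_itv/= => /andP[].
rewrite IH; last exact: ltnW.
rewrite [in RHS]/tail_area big_nat_recr//= EFinD; congr (_ + _)%E.
transitivity (\int[lebesgue_measure]_(t in `[jump_time f k, jump_time f k.+1[)
    (x - k%:R)%:E)%E.
  apply: eq_integral => t; rewrite inE/= in_itv/= => tk.
  have t0 : 0 <= t by case/andP: tk => kt _; rewrite (le_trans _ kt)// jump_time_ge0.
  by move: tk; rewrite jump_time_between// => /eqP ->.
rewrite integral_cst//= lebesgue_measure_itv/= lte_fin.
have [sk'|sk'] := ltP; first by rewrite -EFinB -EFinM.
have -> : jump_time f k.+1 = jump_time f k by apply/le_anti; rewrite sk'.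
by rewrite mule0 subrr mulr0.
Qed.

Lemma passage_area_jump f x c : counting_path f -> reaches f c -> 0 < x ->
  c%:R - 1 < x -> x <= c%:R ->
  passage_area (fun t => x - (f t)%:R) = (tail_area x c (jump_time f) 0)%:E.
Proof.
move=> hf hr x0 cx xc; rewrite /passage_area (passage_time_jump hf hr x0 cx xc).
rewrite -(integral_steps hf hr (ltW cx) (leqnn c)).
rewrite integral_itv_bndo_bndc; last first.
  apply/measurable_EFinP; apply: measurable_path => // t /=.
  by rewrite in_itv/= => /andP[].
congr (integral _ _ _); apply/seteqP; split => t /=; rewrite in_itv/= lee_fin.
  by case=> -> ->.
by case/andP.
Qed.

Lemma passage_time_infty f x c : c%:R - 1 < x -> x <= c%:R -> ~ reaches f c ->
  passage_time (fun t => x - (f t)%:R) = +oo%E.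
Proof.
move=> cx xc nr; rewrite /passage_time -[RHS]ereal_inf0; congr ereal_inf.
apply/seteqP; split => // _ [t [t0 xt] <-]; apply: nr.
by exists t; [exact: ltW|rewrite -(path_below_level _ _ cx xc)].
Qed.

(** A path that never reaches [c] stays at height at least [x - (c - 1) > 0] over an infinite
    time. *)
Lemma passage_area_infty f x c : counting_path f -> c%:R - 1 < x -> x <= c%:R ->
  ~ reaches f c -> passage_area (fun t => x - (f t)%:R) = +oo%E.
Proof.
move=> hf cx xc nr; rewrite /passage_area (passage_time_infty cx xc nr).
have -> : [set t : R | 0 <= t /\ (t%:E <= +oo)%E] = `[0%R, +oo[%classic.
  by apply/seteqP; split => t /=; rewrite in_itv/= andbT leey => // -[].
apply/eqP; rewrite -leye_eq.
apply: (@le_trans _ _ (\int[lebesgue_measure]_(t in `[0%R, +oo[) (x - (c%:R - 1))%:E)%E).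
  rewrite integral_cst//= lebesgue_measure_itv/= ltry addye// gt0_muley//.
  by rewrite lte_fin subr_gt0.
apply: ge0_le_integral => //.
- by move=> t _; rewrite lee_fin subr_ge0 ltW.
- apply/measurable_EFinP; apply: measurable_path => // t /=.
  by rewrite in_itv/= andbT.
move=> t /=; rewrite in_itv/= andbT => t0; rewrite lee_fin lerB//.
rewrite lerBrDr natr1 ler_nat ltnNge; apply/negP => cf; apply: nr.
by exists t.
Qed.

End PassagePath.

(** * Moments of the passage functionals of a Poisson process *)

Section PoissonPassage.
Context (R : realType) d (T : measurableType d) (P : probability T R) (theta : R)
  (N : R -> T -> nat).
Hypothesis theta_gt0 : 0 < theta.
Hypothesis hN : poisson_process P theta N.

Lemma poisson_counting_path w : counting_path (N^~ w).
Proof.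
have [_ N0 Nle Nr _ _] := hN; split => //; first exact: Nle.
(* Tolerance 1 suffices: natural numbers at distance below 1 are equal. *)
move=> t t0; have /cvgrPdist_lt/(_ 1 ltr01) := Nr w t t0.
rewrite near_withinE => -[e /= e0 he]; exists e => // s ts ste.
move: ts; rewrite le_eqVlt => /predU1P[<-//|ts].
have := he s; rewrite /= ltr0_norm ?subr_lt0// opprB ltrBlDl => /(_ ste ts).
have Nts := Nle w t s t0 (ltW ts).
rewrite distrC ger0_norm ?subr_ge0 ?ler_nat// ltrBlDr nat1r ltr_nat ltnS => sN.
by apply/eqP; rewrite eqn_leq sN Nts.
Qed.

Let reach c := [set w | reaches (N^~ w) c].

(** Paths are monotone, so integer times suffice and the union is countable. *)
Lemma measurable_reach c : measurable (reach c).
Proof.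
have [mN _ Nle _ _ _] := hN.
have -> : reach c = \bigcup_n [set w | (c <= N n%:R w)%N].
  apply/seteqP; split => [w [t t0 ct]|w [n _ cn]]; last by exists n%:R.
  exists (Num.bound t) => //=; rewrite (leq_trans ct)// Nle//.
  by have := archi_boundP t0; exact: ltW.
apply: bigcup_measurable => n _; rewrite -[X in measurable X]setTI.
have mf := measurable_fun_leq (measurable_cst c) (mN n%:R (ler0n _ _)).
exact: (mf measurableT [set true]).
Qed.

Lemma probability_not_reach c : P (~` reach c) = 0%E.
Proof.
have [mN N0 Nle _ Nlaw _] := hN.
have mC := measurableC (measurable_reach c).
apply/eqP; rewrite -measure_le0; apply/lee_addgt0Pr => e e0; rewrite add0e.
(* Failing to reach [c] puts [N t] below [c], with probability at most [c * c / (theta * t)]; this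
   [t] makes it at most [e], and the [+ 1] keeps [t] positive when [c = 0]. *)
pose t := (c%:R * c%:R) / (theta * e) + 1.
have t0 : 0 < t by rewrite ltr_wpDl// divr_ge0// mulr_ge0// ltW.
have lvl k : [set w | N t w = k] = [set w | (N t w - N 0 w)%N = k].
  by apply/seteqP; split => w /=; rewrite N0 subn0.
apply: (@le_trans _ _ (\sum_(k < c) P [set w | N t w = k])%E).
  apply: (@content_subadditive _ _ _ P (~` reach c)
    (fun k => [set w | N t w = k]) c) => //.
    move=> k _; rewrite -[X in measurable X]setTI.
    exact: (mN t (ltW t0) measurableT [set k]).
  rewrite -(bigcup_mkord c (fun k => [set w | N t w = k])) => w nw; exists (N t w) => //=.
  by rewrite ltnNge; apply/negP => ct; apply: nw; exists t => //; exact: ltW.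
apply: (@le_trans _ _ (\sum_(k < c) (c%:R / (theta * t))%:E)%E).
  apply: lee_sum => k _; rewrite lvl Nlaw// subr0 lee_fin.
  have tt0 : 0 < theta * t by rewrite mulr_gt0.
  rewrite poisson_pmfE// (le_trans (poisson_weight_le _ tt0))//.
  by rewrite ler_pM2r ?invr_gt0// ler_nat ltn_ord.
rewrite sumEFin sumr_const card_ord lee_fin -[leLHS]mulr_natl mulrA.
rewrite ler_pdivrMr ?mulr_gt0// /t mulrA (mulrC e) mulrDr mulr1 mulrCA mulfV ?mulr1.
  by rewrite lerDl mulr_ge0// ltW.
by rewrite gt_eqF// mulr_gt0.
Qed.

Lemma probability_reachI c A : measurable A -> P (reach c `&` A) = P A.
Proof.
move=> mA; have mr := measurable_reach c.
have e : P (A `\` reach c) = 0%E.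
  apply/eqP; rewrite -measure_le0 -(probability_not_reach c).
  by apply: le_measure; rewrite ?inE; [exact: measurableD|exact: measurableC|move=> w []].
by rewrite setIC; have := measureDI P mA mr; rewrite /= e add0e => <-.
Qed.

(** The starting point of the recursion over domains: the reaching event has probability 1, so
    intersecting with it preserves the law of the increments. *)
Lemma poisson_on_reach c : poisson_on P theta (reach c) N c.
Proof.
have [mN N0 Nle _ Nlaw Nindep] := hN.
split => //; [exact: measurable_reach|exact: poisson_counting_path|].
move=> l t k t0 ht.
have t_ge0 i : 0 <= t i by elim: i => [|i ih]; rewrite ?t0// (le_trans ih)// ltW.
have -> : P (reach c) = 1%E.
  by rewrite -(setIT (reach c)) probability_reachI// probability_setT.
rewrite mul1e probability_reachI; last first.
  apply: bigcap_measurableType => i _; rewrite -[X in measurable X]setTI.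
  have mf := measurable_fun_subn (mN _ (t_ge0 i.+1)) (mN _ (t_ge0 i)).
  exact: (mf measurableT [set k i]).
rewrite (Nindep l t (fun i => [set k i])) ?t0//; last by move=> i; exact: ltW.
rewrite - prodEFin; apply: eq_bigr => i _.
by rewrite -Nlaw.
Qed.

Variables (x : R) (c : nat).
Hypotheses (x_gt0 : 0 < x) (cx : c%:R - 1 < x) (xc : x <= c%:R).

Lemma passage_monomial_reach m n w : reach c w ->
  passage_monomial N m n x w = (monomial m n x c (jump_time (N^~ w)))%:E.
Proof.
move=> hr; have hp := poisson_counting_path w.
rewrite /passage_monomial (passage_time_jump hp hr x_gt0 cx xc).
by rewrite (passage_area_jump hp hr x_gt0 cx xc) -!EFin_expe -EFinM.
Qed.

Lemma passage_monomial_not_reach m n w : ~ reach c w ->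
  passage_monomial N m n x w = (+oo ^+ m * +oo ^+ n)%E.
Proof.
move=> nr; rewrite /passage_monomial (passage_time_infty cx xc nr).
by rewrite (passage_area_infty (poisson_counting_path w) cx xc nr).
Qed.

Lemma passage_monomial_nonneg m n w : (0 <= passage_monomial N m n x w)%E.
Proof.
have [hr|nr] := pselect (reach c w).
  rewrite passage_monomial_reach// lee_fin.
  exact: (jump_monomial_ge0 _ _ (poisson_on_reach c) (ltW cx)).
by rewrite passage_monomial_not_reach// mule_ge0// expe_ge0.
Qed.

(** Off the reaching event the monomial is the constant [+oo ^+ m * +oo ^+ n]. *)
Lemma measurable_passage m n : measurable_fun setT (passage_monomial N m n x).
Proof.
have mr := measurable_reach c.
rewrite -(setUv (reach c)); apply/measurable_funU => //; first exact: measurableC.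
split.
  apply: (eq_measurable_fun (fun w => (monomial m n x c (jump_time (N^~ w)))%:E)).
    by move=> w /[!inE] hr; rewrite passage_monomial_reach.
  by apply/measurable_EFinP; exact: measurable_jump_monomial (poisson_on_reach c).
apply: (eq_measurable_fun (cst (+oo ^+ m * +oo ^+ n)%E)); last exact: measurable_cst.
by move=> w /[!inE] nr; rewrite passage_monomial_not_reach.
Qed.

Lemma integral_passage m n : (\int[P]_w passage_monomial N m n x w)%E =
  (unit_moment (m + n) m n c x / theta ^+ (m + n))%:E.
Proof.
have mr := measurable_reach c.
rewrite (@ge0_negligible_integral _ _ _ _ _ (~` reach c))//; first last.
- exact: probability_not_reach.
- by move=> w _; exact: passage_monomial_nonneg.
- exact: measurable_passage.
- exact: measurableC.
rewrite setTD setCK.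
under eq_integral => w /[!inE] hr do rewrite passage_monomial_reach//.
rewrite (integral_jump_monomial theta_gt0 erefl (ltW cx) (poisson_on_reach c)).
by rewrite -(setIT (reach c)) probability_reachI// probability_setT mul1e.
Qed.

Lemma integrable_passage m n : P.-integrable setT (passage_monomial N m n x).
Proof.
apply/integrableP; split; first exact: measurable_passage.
under eq_integral do rewrite gee0_abs ?passage_monomial_nonneg//.
by rewrite integral_passage ltry.
Qed.

Lemma passage_momentE m n :
  passage_moment P N m n x = unit_moment (m + n) m n c x / theta ^+ (m + n).
Proof. by rewrite /passage_moment x_gt0 integral_passage. Qed.

End PoissonPassage.

(** * The difference equation *)

Section DiscreteAntiderivative.
Variable R : realType.
Implicit Types (p q : {poly R}) (x : R) (k : nat).

(* The rising factorial; [- (- i)] lets the [prod_XsubC] lemmas apply. *)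
Definition rising k : {poly R} := \prod_(i < k) ('X - (- i%:R)%:P).

(** The two values share the factor [x (x + 1) ... (x + k - 1)]; the other factors are [x + k] and
    [x - 1]. *)
Lemma rising_diff k x :
  (rising k.+1).[x] - (rising k.+1).[x - 1] = k.+1%:R * (rising k).[x].
Proof.
rewrite {1}/rising big_ord_recr/= -/(rising k) /rising big_ord_recl/=.
have -> : (('X - (- 0%:R)%:P) * \prod_(i < k) ('X - (- (bump 0 i)%:R)%:P)).[x - 1] =
    (x - 1) * (rising k).[x].
  rewrite hornerM hornerXsubC oppr0 subr0; congr (_ * _).
  rewrite !horner_prod; apply: eq_bigr => i _.
  by rewrite !hornerXsubC /bump/= add1n -natr1; ring.
by rewrite -/(rising k) hornerM hornerXsubC -natr1; ring.
Qed.

Lemma size_rising k : size (rising k) = k.+1.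
Proof. by rewrite size_prod_XsubC [index_enum _]unlock -enumT size_enum_ord. Qed.

Lemma coef_rising k : (rising k)`_k = 1.
Proof.
have /monicP := monic_prod_XsubC (index_enum 'I_k) xpredT (fun i => - i%:R : R).
by rewrite lead_coefE -/(rising k) size_rising.
Qed.

(** A multiple of the rising factorial removes the top coefficient of [q], and induction handles the
    rest. The last clause follows the leading coefficient, to obtain the exact degree later. *)
Lemma discrete_antiderivative k q : (size q <= k)%N ->
  exists p, [/\ (size p <= k.+1)%N, p.[0] = 0,
    forall x, p.[x] - p.[x - 1] = q.[x] & k%:R * p`_k = q`_k.-1].
Proof.
elim: k q => [|k IH] q sq.
  have -> : q = 0 by apply/eqP; rewrite -size_poly_leq0.
  exists 0; split; rewrite ?size_poly0 ?horner0 ?mul0r ?coef0// => x.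
  by rewrite !horner0 subrr.
pose a := q`_k.
have [|p [sp p0 hp _]] := IH (q - a *: rising k).
  apply/leq_sizeP => i; rewrite leq_eqVlt => /predU1P[<-|ki].
    by rewrite coefB coefZ coef_rising mulr1 subrr.
  rewrite coefB coefZ [q`_i]nth_default ?(leq_trans sq)//.
  by rewrite [(rising k)`_i]nth_default ?size_rising// mulr0 subrr.
have k0 : k.+1%:R != 0 :> R by rewrite pnatr_eq0.
exists (p + (a / k.+1%:R) *: rising k.+1); split.
- rewrite (leq_trans (size_polyD _ _))// geq_max (leq_trans sp)//.
  by rewrite (leq_trans (size_scale_leq _ _))// size_rising.
- rewrite hornerD hornerZ p0 add0r /rising big_ord_recl hornerM hornerXsubC.
  by rewrite sub0r opprK mul0r mulr0.
- move=> x; rewrite !hornerD !hornerZ opprD addrACA hp -mulrBr rising_diff.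
  by rewrite hornerD hornerN hornerZ mulrA divfK// subrK.
- rewrite coefD coefZ coef_rising [p`_k.+1]nth_default//= add0r mulr1.
  by rewrite mulrC divfK.
Qed.

End DiscreteAntiderivative.

(** Induction by unit steps from a half-line, matching the difference equation and its boundary
    condition. *)
Lemma real_step_ind (R : archiRealDomainType) (Q : R -> Prop) :
  (forall y, y <= 0 -> Q y) -> (forall x, 0 < x -> Q (x - 1) -> Q x) ->
  forall x, Q x.
Proof.
move=> Q0 QS x.
have [k] : exists k : nat, x <= k%:R.
  by exists (Num.bound `|x|); rewrite (le_trans (ler_norm x))// ltW// archi_boundP.
elim: k x => [|k IH] x xk; first exact: Q0.
have [x0|x0] := leP x 0; first exact: Q0.
by apply: QS => //; apply: IH; rewrite lerBlDr natr1.
Qed.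

(** A mean value bound on a unit step of a power; it drives the lower bound on the moments. *)
Lemma exprSB1_ge (R : realDomainType) (x : R) k : 1 <= x ->
  x ^+ k.+1 <= (x - 1) ^+ k.+1 + k.+1%:R * x ^+ k.
Proof.
move=> x1; have x0 : 0 <= x by rewrite (le_trans ler01).
have y0 : 0 <= x - 1 by rewrite subr_ge0.
elim: k => [|k IH]; first by rewrite !expr1 expr0 mulr1 subrK.
rewrite exprS (le_trans (ler_wpM2l x0 IH))//.
have -> : x * ((x - 1) ^+ k.+1 + k.+1%:R * x ^+ k) =
    (x - 1) ^+ k.+2 + ((x - 1) ^+ k.+1 + k.+1%:R * x ^+ k.+1).
  by rewrite !exprS; ring.
rewrite -[k.+2%:R]natr1 [k.+1%:R + 1]addrC mulrDl mul1r lerD2l lerD2r.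
by rewrite lerXn2r ?nnegrE// gerBl.
Qed.

(** * Degree and growth of the solutions of the recursion *)

Section MomentRecursion.
Variables (R : realType) (theta : R) (V : nat -> nat -> R -> R).
Hypothesis theta_gt0 : 0 < theta.
Hypothesis V_le0 : forall m n y, y <= 0 -> V m n y = 0.
Hypothesis V00 : forall x, 0 < x -> V 0 0 x = 1.
Hypothesis V_rec : forall m n x, (0 < m + n)%N -> 0 < x ->
  V m n x = V m n (x - 1) +
    theta^-1 * (n%:R * (x * V m n.-1 x) + m%:R * V m.-1 n x).

(** The increment is a polynomial of degree [m + 2 * n - 1] with positive leading coefficient;
    discrete integration raises the degree by one. At order (0, 0) the polynomial is 1 while the
    moment is 0 at 0, hence the restrictions on [k] and on [p.[0]]. *)
Lemma moment_poly m n : exists p : {poly R},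
  [/\ (size p <= (m + 2 * n).+1)%N, 0 < p`_(m + 2 * n),
    forall k : nat, (0 < k)%N -> V m n k%:R = p.[k%:R] &
    (0 < m + n)%N -> p.[0] = 0].
Proof.
have [s] := ubnP (m + n); elim: s => // s IH in m n *; rewrite ltnS => mns.
have [mn0|mn_gt0] := posnP (m + n).
  move/eqP: mn0; rewrite addn_eq0 => /andP[/eqP-> /eqP->].
  exists 1; split => //; first by rewrite size_poly1.
    by rewrite coef1.
  by move=> k k0; rewrite hornerC V00// ltr0n.
pose D := (m + 2 * n).-1; have DE : (m + 2 * n)%N = D.+1 by rewrite /D; lia.
(* For [m = 0] this contribution is 0, so its coefficient is positive only if [0 < m]; [q2] behaves
   likewise in [n], and one of the two is positive. *)
have [q1 [sq1 cq1 hq1]] : exists q : {poly R}, [/\ (size q <= D.+1)%N,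
    (0 <= q`_D) && ((0 < m)%N ==> (0 < q`_D)) &
    forall k : nat, (0 < k)%N -> m%:R * V m.-1 n k%:R = q.[k%:R]].
  have [m0|m0] := posnP m.
    exists 0; split; rewrite ?size_poly0 ?coef0 ?lexx ?m0// => k k0.
    by rewrite horner0 mul0r.
  have [|p [sp cp hp _]] := IH m.-1 n; first lia.
  have DE1 : (m.-1 + 2 * n)%N = D by rewrite /D; lia.
  rewrite DE1 in sp cp; have m1 : 0 < m%:R :> R by rewrite ltr0n.
  exists (m%:R *: p); split.
  - by rewrite (leq_trans (size_scale_leq _ _)).
  - by rewrite coefZ mulr_ge0 ?(ltW cp)//= mulr_gt0// implybT.
  - by move=> k k0; rewrite hornerZ hp.
have [q2 [sq2 cq2 hq2]] : exists q : {poly R}, [/\ (size q <= D.+1)%N,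
    (0 <= q`_D) && ((0 < n)%N ==> (0 < q`_D)) &
    forall k : nat, (0 < k)%N -> n%:R * (k%:R * V m n.-1 k%:R) = q.[k%:R]].
  have [n0|n0] := posnP n.
    exists 0; split; rewrite ?size_poly0 ?coef0 ?lexx ?n0// => k k0.
    by rewrite horner0 mul0r.
  have [|p [sp cp hp _]] := IH m n.-1; first lia.
  have DE1 : (m + 2 * n.-1).+1 = D by rewrite /D; lia.
  have n1 : 0 < n%:R :> R by rewrite ltr0n.
  exists (n%:R *: (p * 'X)); split.
  - rewrite (leq_trans (size_scale_leq _ _))// (leq_trans (size_polyMleq _ _))//.
    by rewrite size_polyX addn2/= ltnS -DE1.
  - by rewrite coefZ coefMX -DE1/= mulr_ge0 ?(ltW cp)//= mulr_gt0// implybT.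
  - by move=> k k0; rewrite hornerZ hornerMX hp// [p.[_] * _]mulrC.
pose q := theta^-1 *: (q2 + q1).
have sq : (size q <= D.+1)%N.
  rewrite (leq_trans (size_scale_leq _ _))// (leq_trans (size_polyD _ _))//.
  by rewrite geq_max sq2.
have cq : 0 < q`_D.
  rewrite coefZ mulr_gt0 ?invr_gt0// coefD.
  case/andP: cq1 => q10 /implyP q1p; case/andP: cq2 => q20 /implyP q2p.
  have [n0|n0] := posnP n; last by rewrite ltr_wpDr// q2p.
  by rewrite ltr_wpDl// q1p//; lia.
have [p [sp p0 hp cp]] := discrete_antiderivative sq.
exists p; rewrite DE; split => //.
- have : 0 < D.+1%:R * p`_D.+1 by rewrite cp.
  by rewrite pmulr_rgt0// ltr0n.
- move=> k _; elim: k => [|k ih]; first by rewrite V_le0// p0.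
  rewrite V_rec// ?ltr0n// hq1// hq2// -hornerD -hornerZ -/q -hp.
  have -> : k.+1%:R - 1 = k%:R :> R by rewrite -natr1 addrK.
  by rewrite ih addrC subrK.
Qed.

(** The upper bound has [x + 1] because moments need not tend to 0 at [0+]: [V 1 0] is [theta^-1] on
    []0, 1]]. *)
Lemma moment_bounds m n : exists a b, [/\ 0 < a, 0 < b &
  forall x, 0 < x ->
    a * x ^+ (m + 2 * n) <= V m n x <= b * (x + 1) ^+ (m + 2 * n)].
Proof.
have [s] := ubnP (m + n); elim: s => // s IH in m n *; rewrite ltnS => mns.
have [mn0|mn_gt0] := posnP (m + n).
  move/eqP: mn0; rewrite addn_eq0 => /andP[/eqP-> /eqP->].
  by exists 1, 1; split => // x x0; rewrite !expr0 V00// mulr1 lexx.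
pose D := (m + 2 * n).-1; have DE : (m + 2 * n)%N = D.+1 by rewrite /D; lia.
have [a1 [b1 [a10 a1p b10 h1]]] : exists a b, [/\ 0 <= a, (0 < m)%N -> 0 < a, 0 <= b &
    forall x, 0 < x -> a * x ^+ D <= m%:R * V m.-1 n x <= b * (x + 1) ^+ D].
  have [m0|m0] := posnP m.
    by exists 0, 0; split; rewrite ?m0 ?lexx// => x x0; rewrite !mul0r lexx.
  have [|a [b [a0 b0 h]]] := IH m.-1 n; first lia.
  have DE1 : (m.-1 + 2 * n)%N = D by rewrite /D; lia.
  rewrite DE1 in h; have m1 : 0 < m%:R :> R by rewrite ltr0n.
  exists (m%:R * a), (m%:R * b); split => [||| x x0];
    rewrite ?mulr_ge0 ?mulr_gt0 ?(ltW a0) ?(ltW b0)//.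
  by rewrite -!mulrA !ler_pM2l// h.
have [a2 [b2 [a20 a2p b20 h2]]] : exists a b, [/\ 0 <= a, (0 < n)%N -> 0 < a, 0 <= b &
    forall x, 0 < x -> a * x ^+ D <= n%:R * (x * V m n.-1 x) <= b * (x + 1) ^+ D].
  have [n0|n0] := posnP n.
    by exists 0, 0; split; rewrite ?n0 ?lexx// => x x0; rewrite !mul0r lexx.
  have [|a [b [a0 b0 h]]] := IH m n.-1; first lia.
  have DE1 : (m + 2 * n.-1).+1 = D by rewrite /D; lia.
  have n1 : 0 < n%:R :> R by rewrite ltr0n.
  exists (n%:R * a), (n%:R * b); split => [||| x x0];
    rewrite ?mulr_ge0 ?mulr_gt0 ?(ltW a0) ?(ltW b0)//.
  rewrite -!mulrA !ler_pM2l// -DE1 !exprS [a * (x * _)]mulrCA [b * ((x + 1) * _)]mulrCA.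
  have /andP[ha hb] := h x x0; have x0' := ltW x0; apply/andP; split.
    by rewrite ler_pM2l.
  by rewrite ler_pM ?lerDl// (le_trans _ ha)// mulr_ge0 ?exprn_ge0// ltW.
pose g x := theta^-1 * (n%:R * (x * V m n.-1 x) + m%:R * V m.-1 n x).
pose a := theta^-1 * (a2 + a1); pose b := theta^-1 * (b2 + b1).
have gP x : 0 < x -> a * x ^+ D <= g x <= b * (x + 1) ^+ D.
  move=> x0; rewrite -!mulrA !ler_pM2l ?invr_gt0// !mulrDl.
  by have /andP[p1 p2] := h1 x x0; have /andP[p3 p4] := h2 x x0; rewrite !lerD.
have a0 : 0 < a.
  rewrite mulr_gt0 ?invr_gt0//.
  have [n0|n0] := posnP n; last by rewrite ltr_wpDr// a2p.
  by rewrite ltr_wpDl// a1p//; lia.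
(* [b1] and [b2] are only known to be nonnegative; comparing both bounds of [g] at 1 forces [b] to
   be positive. *)
have b0 : 0 < b.
  have /andP[p q] := gP 1 ltr01; have := le_trans p q.
  rewrite expr1n mulr1 => h; have := lt_le_trans a0 h.
  by rewrite pmulr_lgt0// exprn_gt0// addr_gt0.
(* Division by [D.+1] compensates the factor of [exprSB1_ge]. *)
exists (a / D.+1%:R), b; rewrite DE; split => //; first by rewrite divr_gt0.
have D1 : 0 < D.+1%:R :> R by rewrite ltr0n.
apply: real_step_ind => [y y0|x x0 IHx _]; first by rewrite ltNge y0.
have x0' := ltW x0; rewrite V_rec// -/(g x); have /andP[ga gb] := gP x x0.
apply/andP; split.
- have [x1|x1] := leP x 1.
    rewrite V_le0 ?subr_le0// add0r (le_trans _ ga)//.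
    rewrite -mulrA ler_pM2l// exprS ler_pdivrMl// ler_pM ?exprn_ge0//.
    by rewrite (le_trans x1)// ler1n.
  have /IHx/andP[h _] : 0 < x - 1 by rewrite subr_gt0.
  apply: le_trans (lerD h ga).
  have -> : a * x ^+ D = a / D.+1%:R * (D.+1%:R * x ^+ D).
    by rewrite mulrA divfK// gt_eqF.
  by rewrite -mulrDr ler_pM2l ?divr_gt0// exprSB1_ge// ltW.
(* The induction closes because [(x + 1) ^+ D.+1] is [x * (x + 1) ^+ D + (x + 1) ^+ D]. *)
- apply: (@le_trans _ _ (b * x ^+ D.+1 + b * (x + 1) ^+ D)).
    rewrite lerD//; have [x1|x1] := leP x 1.
      by rewrite V_le0 ?subr_le0// mulr_ge0 ?exprn_ge0// ltW.
    have /IHx/andP[_] : 0 < x - 1 by rewrite subr_gt0.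
    by rewrite subrK.
  rewrite -mulrDr ler_pM2l// !exprS mulrDl mul1r lerD2r ler_pM2l//.
  by rewrite lerXn2r ?nnegrE ?addr_ge0// lerDl.
Qed.

End MomentRecursion.

(** The ceiling is given as a successor, the form [unit_moment_recl] expects. *)
Lemma nat_ceil_exists (R : realType) (x : R) : 0 < x ->
  exists c : nat, c.+1%:R - 1 < x /\ x <= c.+1%:R.
Proof.
move=> x0; have ex : exists n : nat, x <= n%:R.
  by exists (Num.bound x); rewrite ltW// archi_boundP// ltW.
case: (ex_minnP ex) => -[|c] xc cmin; first by move: x0; rewrite ltNge xc.
exists c; split => //; rewrite -natr1 addrK ltNge; apply/negP => /cmin.
by rewrite ltnn.
Qed.

(** * The recursion satisfied by the passage moments *)

Section PassageMoment.
Context (R : realType) d (T : measurableType d) (P : probability T R) (theta : R)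
  (N : R -> T -> nat).
Hypothesis theta_gt0 : 0 < theta.
Hypothesis hN : poisson_process P theta N.

Lemma passage_moment_le0 m n y : y <= 0 -> passage_moment P N m n y = 0.
Proof. by rewrite /passage_moment leNgt => /negbTE ->. Qed.

Lemma passage_moment00 x : 0 < x -> passage_moment P N 0 0 x = 1.
Proof.
move=> x0; have [c [cx xc]] := nat_ceil_exists x0.
by rewrite (passage_momentE theta_gt0 hN x0 cx xc) expr0 divr1.
Qed.

Lemma passage_moment_rec m n x : (0 < m + n)%N -> 0 < x ->
  passage_moment P N m n x = passage_moment P N m n (x - 1) +
    theta^-1 * (n%:R * (x * passage_moment P N m n.-1 x) +
                m%:R * passage_moment P N m.-1 n x).
Proof.
move=> mn x0; have [c [cx xc]] := nat_ceil_exists x0.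
have [s mns] : exists s, (m + n)%N = s.+1 by exists (m + n).-1; rewrite prednK.
have E m' n' := passage_momentE theta_gt0 hN x0 cx xc m' n'.
(* The ceiling of [x - 1] is [c] when [x > 1]; otherwise [c = 0], and the empty sum agrees with the
   boundary value 0. *)
have -> : passage_moment P N m n (x - 1) =
    unit_moment s.+1 m n c (x - 1) / theta ^+ s.+1.
  have [x1|x1] := ltP 0 (x - 1).
    rewrite (passage_momentE theta_gt0 hN x1 (c := c)) ?mns//.
      by move: cx; rewrite -natr1; lra.
    by move: xc; rewrite -natr1; lra.
  suff -> : c = 0%N by rewrite /= big_ord0 mul0r passage_moment_le0.
  apply/eqP; rewrite -leqn0 -ltnS -(ltr_nat R).
  by rewrite -subr_le0 in x1; move: cx; rewrite -natr1 addrK; lra.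
have En : n%:R * (x * passage_moment P N m n.-1 x) =
    n%:R * x * unit_moment s m n.-1 c.+1 x / theta ^+ s.
  case: n mns => [|n'] mns in mn *; first by rewrite !mul0r.
  by rewrite E /= (_ : m + n' = s)%N ?mulrA//; lia.
have Em : m%:R * passage_moment P N m.-1 n x =
    m%:R * unit_moment s m.-1 n c.+1 x / theta ^+ s.
  case: m mns => [|m'] mns in mn En *; first by rewrite !mul0r.
  by rewrite E /= (_ : m' + n = s)%N ?mulrA//; lia.
rewrite E En Em mns unit_moment_recl exprS; field.
by rewrite expf_neq0 gt_eqF.
Qed.

End PassageMoment.

Lemma cvg_divr_exprS (R : realType) (K : R) s :
  K / theta ^+ s.+1 @[theta --> +oo] --> 0.
Proof.
apply/cvgrPdist_le => e e0; near=> t.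
have t1 : 1 <= t by near: t; exact: nbhs_pinfty_ge.
have t0 : 0 < t := lt_le_trans ltr01 t1.
rewrite sub0r normrN normrM normfV (ger0_norm (exprn_ge0 _ (ltW t0))).
rewrite ler_pdivrMr ?exprn_gt0//.
apply: (@le_trans _ _ (e * t)).
  by rewrite -ler_pdivrMl//; near: t; exact: nbhs_pinfty_ge.
by rewrite ler_pM2l// exprS ler_peMr ?(ltW t0)// exprn_ege1.
Unshelve. all: by end_near. Qed.

(** Each intensity has its own space and process, as the limit condition varies [theta]. The problem
    is posed for [0 < m + n]: the moment of order (0, 0) is the indicator of [x > 0], which jumps at
    0 and does not tend to 0 in [theta]. *)
Theorem theorem3p4 (R : realType) (d : measure_display)
    (T : R -> measurableType d)
    (P : forall theta : R, probability (T theta) R)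
    (N : forall theta : R, R -> T theta -> nat)
    (hN : forall theta : R, 0 < theta ->
       poisson_process (P theta) theta (N theta)) :
  let V m n theta x := passage_moment (P theta) (N theta) m n x in
  [/\ (* the moments exist *)
      forall (theta x : R) (m n : nat), 0 < theta -> 0 < x ->
        (P theta).-integrable setT (passage_monomial (N theta) m n x),
      (* they are the solution of the problem *)
      forall m n : nat, (0 < m + n)%N ->
        moment_problem V m n (V m n) /\
        (forall U : R -> R -> R, moment_problem V m n U ->
           forall theta x : R, 0 < theta -> U theta x = V m n theta x)
    & forall (theta : R) (m n : nat), 0 < theta ->
      [/\ V m n theta 0 = 0,
          exists p : {poly R},
            [/\ size p = (m + 2 * n).+1,
                forall k : nat, (0 < k)%N -> V m n theta k%:R = p.[k%:R]
              & (0 < m + n)%N -> p.[0] = 0]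
        & (fun x : R => V m n theta x)
            \is 'Theta_(within [set x : R | x \isn't a Num.nat] +oo)
                  (fun x : R => x ^+ (m + 2 * n))]].
Proof.
move=> V.
have V_le0 theta m n y : y <= 0 -> V m n theta y = 0.
  exact: passage_moment_le0.
have V00 theta x : 0 < theta -> 0 < x -> V 0 0 theta x = 1.
  by move=> th0 x0; exact: (passage_moment00 th0 (hN _ th0) x0).
have V_rec theta m n x (th0 : 0 < theta) :=
  @passage_moment_rec _ _ _ _ _ _ th0 (hN _ th0) m n x.
split.
- move=> theta x m n th0 x0; have [c [cx xc]] := nat_ceil_exists x0.
  exact: (integrable_passage th0 (hN _ th0) x0 cx xc).
- move=> m n mn; split; [split|].
  + move=> theta x th0 x0; rewrite [V m n theta x]V_rec// -/(V _ _ _ _).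
    rewrite /V; field; exact: lt0r_neq0.
  + by move=> theta y _; exact: V_le0.
  + move=> x; have [x0|x0] := leP x 0.
      by under eq_fun do rewrite V_le0//; exact: cvg_cst.
    have [c [cx xc]] := nat_ceil_exists x0.
    have [s mns] : exists s, (m + n)%N = s.+1 by exists (m + n).-1; rewrite prednK.
    apply: cvg_trans (cvg_divr_exprS (unit_moment s.+1 m n c.+1 x) s).
    apply: near_eq_cvg; near=> theta.
    have th0 : 0 < theta by near: theta; exact: nbhs_pinfty_gt.
    by rewrite /V (passage_momentE th0 (hN _ th0) x0 cx xc) mns.
  (* The equation gives [U theta x] from [U theta (x - 1)] and the lower moments, so uniqueness
     follows by unit steps. *)
  + move=> U [Ueq U0 _] theta x th0; move: x; apply: real_step_ind => [y y0|x x0 IH].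
      by rewrite U0// V_le0.
    rewrite [RHS]V_rec// -/(V _ _ _ _) -IH.
    have := Ueq theta x th0 x0.
    move=> /(congr1 ( *%R theta^-1)); rewrite mulKf ?gt_eqF// => e.
    by rewrite -[LHS](subrK (U theta (x - 1))) -opprB e /V; ring.
- move=> theta m n th0; split; first exact: V_le0.
  + have [p [sp cp hp p0]] := moment_poly th0 (V_le0 theta) (V00 theta ^~ th0)
      (fun m n x => V_rec theta m n x th0) m n.
    (* The positive coefficient of index [m + 2 * n] makes the size bound an equality. *)
    exists p; split => //; apply/eqP; rewrite eqn_leq sp/= ltnNge.
    by apply/negP => /leq_sizeP/(_ _ (leqnn _)) pE; move: cp; rewrite pE ltxx.
  + have [a [b [a0 b0 h]]] := moment_bounds th0 (V_le0 theta) (fun x => V00 theta x th0)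
      (fun m n x => V_rec theta m n x th0) m n.
    (* The power of 2 comes from [x + 1 <= 2 * x] for [x >= 1]. *)
    apply/asboolP; exists (a, b * 2 ^+ (m + 2 * n)) => /=.
      by rewrite a0 mulr_gt0// exprn_gt0.
    rewrite near_withinE; near=> x => _.
    have x1 : 1 <= x by near: x; exact: nbhs_pinfty_ge.
    have x0 : 0 < x := lt_le_trans ltr01 x1; have x0' := ltW x0.
    have /andP[ha hb] := h x x0.
    have V0 : 0 <= V m n theta x by rewrite (le_trans _ ha)// mulr_ge0 ?exprn_ge0// ltW.
    rewrite !ger0_norm ?exprn_ge0//; split => //.
    rewrite (le_trans hb)// -mulrA ler_pM2l// -exprMn.
    by rewrite lerXn2r ?nnegrE ?addr_ge0 ?mulr_ge0// mulrDl !mul1r lerD2l.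
Unshelve. all: by end_near. Qed.
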